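(* Let $(S,\preceq,\lambda)$ be a standard, connected poset, and let $\boldsymbol{Y}=(Y_1,Y_2,\ldots)$ be the sequence of ladder variables associated with an IID sequence $\boldsymbol{X}=(X_1,X_2,\ldots)$ in $S$. If the conditional distribution of $Y_1$ given $Y_2=y$ is uniform on $D[y]$, then the common distribution of $\boldsymbol{X}$ has constant rate.
   Context: For a poset $(S,\preceq)$ let $D[x]=\{t\in S: t\preceq x\}$. Write $x\perp y$ if $x\preceq y$ or $y\preceq x$. The poset is connected if for all $x,y\in S$ there is a finite sequence $x=x_0,x_1,\ldots,x_n=y$ with $x_{i-1}\perp x_i$ for $i=1,\ldots,n$. A standard poset $(S,\preceq,\lambda)$ is a poset with a topology and a Borel measure such that: $S$ is locally compact, locally convex (every point has a neighborhood base of convex sets, where $A$ is convex if $a,b\in A$, $a\preceq x\preceq b$ imply $x\in A$) and has a countable base; $\{(x,y)\in S^2: x\preceq y\}$ is closed in $S^2$; $D[x]$ is compact for each $x\in S$; $\lambda$ is a positive Borel measure, finite on compact sets, with $\lambda(V)>0$ for every nonempty open $V$. PDFs and uniform distributions are with respect to the reference measure $\lambda$. Random variables in $S$ have a Borel distribution with support $S$. The variables $X_i$ are independent with common upper probability function $F:S\to(0,1]$, $F(x)=\mathbb{P}(X_i\succeq x)$, and common PDF $f$; the rate function is $r=f/F:S\to(0,\infty)$. The distribution has constant rate $\alpha>0$ if $\alpha F$ is a PDF of it (that is, the rate function is the constant $\alpha$); it has constant rate if this holds for some $\alpha>0$. Ladder variables: $N_1=1$, $Y_1=X_1$, and recursively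 $N_{n+1}=\min\{k>N_n: X_k\succeq Y_n\}$, $Y_{n+1}=X_{N_{n+1}}$.
   Formalization: ''Uniform on D[y]'' is required of the conditional density at every point x (for almost every y), in the version attached to a given positive PDF f; uniformity only as distributions is not enough, since the claim then fails for posets connected only through a null point. *)

(* Defs.v *)
From HB Require Import structures.
From mathcomp Require Import all_boot all_order all_algebra.
From mathcomp Require Import all_classical all_reals all_analysis.

Set Implicit Arguments.
Unset Strict Implicit.
Unset Printing Implicit Defensive.

Import Order.TTheory GRing.Theory Num.Theory.
Import numFieldNormedType.Exports.

Local Open Scope classical_set_scope.
Local Open Scope ring_scope.

(* A partially ordered topological space with no link assumed between order and
   topology.  The distinguished point is only there because the library equips
   [g_sigma_algebraType] with its measurable structure over pointed types. *)
Notation posetTopType := POrderedPointedTopological.type.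

Notation borel S := (g_sigma_algebraType (@open S)).

Section StandardPoset.
Context (d : Order.disp_t) (S : posetTopType d) (R : realType).
Implicit Type lambda : {measure set (borel S) -> \bar R}.

Definition down (x : S) : set S := [set t | (t <= x)%O].
Definition up (x : S) : set S := [set t | (x <= t)%O].

Definition order_convex (A : set S) : Prop :=
  forall a b x : S, A a -> A b -> (a <= x)%O -> (x <= b)%O -> A x.

Definition poset_connected : Prop :=
  forall x y : S,
    exists s : seq S, path (fun a b : S => (a >=< b)%O) x s /\ last x s = y.

(* Compact sets are Borel here, since [sp_closed_order] makes [S] Hausdorff. *)
Record standard_poset lambda : Prop := StandardPoset {
  sp_locally_compact : locally_compact [set: S];
  sp_locally_convex : forall (x : S) (U : set S), nbhs x U ->
    exists V : set S, [/\ nbhs x V, V `<=` U & order_convex V];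
  sp_countable_base : @second_countable S;
  sp_closed_order : closed [set p : S * S | (p.1 <= p.2)%O];
  sp_compact_down : forall x : S, compact (down x);
  sp_finite_compact : forall K : set S, compact K -> (lambda K < +oo)%E;
  sp_positive_open : forall V : set S, open V -> V !=set0 -> (0 < lambda V)%E
}.

End StandardPoset.

Section Distributions.
Context (d : Order.disp_t) (S : posetTopType d) (R : realType).
Implicit Types (lambda : {measure set (borel S) -> \bar R})
  (mu : set (borel S) -> \bar R) (f : borel S -> R).

Definition has_full_support mu : Prop :=
  forall V : set S, open V -> V !=set0 -> (0 < mu V)%E.

Definition is_pdf lambda mu f : Prop :=
  [/\ measurable_fun [set: borel S] f,
      forall x, 0 <= f x &
      forall A : set (borel S), measurable A ->
        mu A = (\int[lambda]_(x in A) (f x)%:E)%E].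

Definition upper_prob mu (x : S) : R := fine (mu (up x)).

Definition constant_rate lambda mu : Prop :=
  exists alpha : R,
    0 < alpha /\ is_pdf lambda mu (fun x => alpha * upper_prob mu x).

(* The uniform distribution on [D] exists only if [0 < lambda D < +oo]. *)
Definition is_uniform_pdf lambda (D : set S) f : Prop :=
  [/\ (0 < lambda D)%E, (lambda D < +oo)%E &
      forall x, f x = \1_D x / fine (lambda D)].

End Distributions.

Section Ladder.
Context (d : Order.disp_t) (S : posetTopType d).

(* The least [k > m] with [s m <= s k].  If there is none the value is [m]: for
   an IID sequence whose upper probability function is positive this happens
   with probability 0. *)
Definition next_ladder_time (s : nat -> S) (m : nat) : nat :=
  match pselect (exists k : nat, (m < k)%N && (s m <= s k)%O) with
  | left ex => ex_minn ex
  | right _ => m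
  end.

Fixpoint ladder_time (s : nat -> S) (n : nat) : nat :=
  if n is n'.+1 then next_ladder_time s (ladder_time s n') else 0.

(* Sequences start at index 0, so [ladder s n] is Y_(n+1) for [s k] = X_(k+1). *)
Definition ladder (s : nat -> S) (n : nat) : S := s (ladder_time s n).

Definition set_first (x : S) (s : nat -> S) : nat -> S :=
  fun k => if k is 0 then x else s k.

End Ladder.

Section RandomLadder.
Context (d : Order.disp_t) (S : posetTopType d) (R : realType).
Context (dT : measure_display) (T : measurableType dT) (P : probability T R).
Context (X : nat -> {RV P >-> borel S}).

Definition iid : Prop :=
  (forall (n : nat) (B : set (borel S)), measurable B ->
     P (X n @^-1` B) = P (X 0%N @^-1` B)) /\
  (forall (s : seq nat) (B : nat -> set (borel S)), uniq s ->
     (forall i, measurable (B i)) ->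
     P (\bigcap_(i in [set` s]) (X i @^-1` B i)) =
       (\prod_(i <- s) P (X i @^-1` B i))%E).

Definition ladder_var (n : nat) : T -> borel S :=
  fun w => ladder (fun k => X k w) n.

(* Since Y_1 = X_1 is independent of (X_2, X_3, ...), the conditional
   distribution of the ladder sequence given Y_1 = x is obtained by substituting
   x for X_1; this defines it at every x, not only at almost every x. *)
Definition ladder_var_given_first (x : S) (n : nat) : T -> borel S :=
  fun w => ladder (set_first x (fun k => X k w)) n.

(* [h] is a PDF of (Y_1, Y_2) with respect to lambda x lambda (first two
   clauses; rectangles determine the distribution), in the version attached to
   the given PDF [f] of Y_1: for every x, y |-> h x y / f x is a PDF of the
   conditional distribution of Y_2 given Y_1 = x (last clause). The density
   x, y |-> f x / F x * f y on x <= y is such an [h]. *)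
Definition is_ladder_pdf (lambda : {measure set (borel S) -> \bar R})
    (f : borel S -> R) (h : borel S -> borel S -> R) : Prop :=
  [/\ measurable_fun [set: borel S * borel S] (fun z => h z.1 z.2) /\
        (forall x y, 0 <= h x y),
      forall A B : set (borel S), measurable A -> measurable B ->
        P (ladder_var 0 @^-1` A `&` ladder_var 1 @^-1` B) =
          (\int[lambda]_(x in A) \int[lambda]_(y in B) (h x y)%:E)%E &
      forall x : S,
        is_pdf lambda (fun B => P (ladder_var_given_first x 1 @^-1` B))
          (fun y => h x y / f x)].

(* Conditional PDF, at the point x, of the first coordinate given that the
   second is y. *)
Definition cond_pdf (lambda : {measure set (borel S) -> \bar R})
    (h : borel S -> borel S -> R) (y x : borel S) : R :=
  h x y / fine (\int[lambda]_u (h u y)%:E)%E.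

(* The conditional distribution of Y_1 given Y_2 = y is uniform on down y, for
   almost every y with respect to the distribution of Y_2.

   Densities are compared at every point x rather than lambda-almost everywhere,
   and this matters.  On the real line, let x <= y mean x * y >= 0 and
   |x| <= |y|, and let lambda be Lebesgue measure: this is a standard poset,
   connected only through the null point 0.  Let X have density p a exp(-a x)
   for x > 0 and (1 - p) b exp(b x) for x < 0.  The density of Y_1 given Y_2 = y
   is uniform on down y up to a null set for all y <> 0, yet the rate is a on
   one side and b on the other.  Requiring constancy of the conditional PDF at
   x = 0 as well forces a = b. *)
Definition cond_uniform (lambda : {measure set (borel S) -> \bar R})
    (f : borel S -> R) : Prop :=
  exists2 h : borel S -> borel S -> R,
    is_ladder_pdf lambda f h &
    {ae P, forall w : T,
       is_uniform_pdf lambda (down (ladder_var 1 w))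
         (cond_pdf lambda h (ladder_var 1 w))}.

End RandomLadder.

(* Main.v *)
Require Import Defs.
From HB Require Import structures.
From mathcomp Require Import all_boot all_order all_algebra.
From mathcomp Require Import all_classical all_reals all_analysis.
From mathcomp Require Import measurable_realfun.

Set Implicit Arguments.
Unset Strict Implicit.
Unset Printing Implicit Defensive.

Import Order.TTheory GRing.Theory Num.Theory.
Import numFieldNormedType.Exports.

Local Open Scope classical_set_scope.
Local Open Scope ring_scope.

(** Write mu for the law of X_1, F for its upper probability function and
    r = f / F for its rate.  The proof compares two formulas for the joint
    density h of (Y_1, Y_2) in the version attached to f.

    Conditionally on Y_1 = x, the next ladder variable is the first later X_k
    that lies in up x, so its law is mu conditioned on up x
    ([distribution_ladder_var_given_first], a geometric series).  By almost
    everywhere uniqueness of densities, for every fixed x,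
    h x y = r x * f y on x <= y, for lambda-almost every y.  On the other hand
    uniformity says that for almost every value y of Y_2 the function h _ y is
    constant on down y ([uniform_cond_pdf_eq]).  If x <= x' and a single point
    y >= x' enjoys all these properties, then
    r x * f y = h x y = h x' y = r x' * f y, hence r x = r x' ([le_rate_eq]).

    Such a y is found as a value of Y_2.  Since Y_2 is always one of the X_k, it
    almost surely avoids a given lambda-null set ([ae_ladder_var]); since
    Y_2 >= X_1, it lies above x' with probability at least F x' > 0.

    Connectedness then spreads the equality of rates along chains of comparable
    points: r is a constant alpha, and f = alpha F pointwise. *)

(** * Upper sets and closed sets are Borel *)

Section ClosedOrder.
Context (d : Order.disp_t) (S : posetTopType d).

Lemma closed_up (x : S) :
  closed [set p : S * S | (p.1 <= p.2)%O] -> closed (up x).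
Proof.
move=> closed_order.
have pair_cont : continuous (fun y : S => (x, y)).
  by move=> y; apply: cvg_pair; [exact: cvg_cst | exact: cvg_id].
exact: (iffLR (continuous_closedP _) pair_cont _ closed_order).
Qed.

Lemma closed_measurable (C : set S) :
  closed C -> measurable (C : set (borel S)).
Proof.
move=> closedC; rewrite -[C]setCK; apply: measurableC.
by apply: sub_sigma_algebra; exact: closed_openC.
Qed.

End ClosedOrder.

(** * The next ladder time of a deterministic sequence *)

Section NextLadderTime.
Context (d : Order.disp_t) (S : posetTopType d).
Implicit Type s : nat -> S.

Lemma ladder1E s : ladder s 1 = s (next_ladder_time s 0).
Proof. by []. Qed.

(** This also holds for a sequence that never meets [up (s 0)] again, because
    the ladder then stays at [s 0]. *)
Lemma ladder1_ge s : (s 0 <= ladder s 1)%O.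
Proof.
rewrite ladder1E /next_ladder_time; case: pselect => // ex.
by case: ex_minnP => k /andP[].
Qed.

Lemma next_ladder_time_first s k :
    (0 < k)%N -> (s 0 <= s k)%O ->
    (forall j, (0 < j < k)%N -> ~~ (s 0 <= s j)%O) ->
  next_ladder_time s 0 = k.
Proof.
move=> k_gt0 s0k before; rewrite /next_ladder_time.
case: pselect => [ex|]; last first.
  by case; exists k; rewrite k_gt0.
case: ex_minnP => m /andP[m_gt0 s0m] min_m.
have le_mk : (m <= k)%N by apply: min_m; rewrite k_gt0.
apply/eqP; rewrite eqn_leq le_mk leqNgt /=; apply/negP => lt_mk.
by have := before m; rewrite m_gt0 lt_mk s0m; move/(_ isT).
Qed.

Lemma next_ladder_time_none s :
  (forall k, (0 < k)%N -> ~~ (s 0 <= s k)%O) -> next_ladder_time s 0 = 0%N.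
Proof.
move=> none; rewrite /next_ladder_time; case: pselect => // ex.
by have [k /andP[k_gt0]] := ex; rewrite (negbTE (none k k_gt0)).
Qed.

End NextLadderTime.

(** * The first visit of an IID sequence to a set *)

Section FirstHit.
Context (d : Order.disp_t) (S : posetTopType d) (R : realType).
Context (dT : measure_display) (T : measurableType dT) (P : probability T R).
Context (X : nat -> {RV P >-> borel S}).
Local Notation mu := (distribution P (X 0%N)).
Implicit Types U B : set (borel S).

(** The time 0 is excluded, as it is occupied by the starting point of the
    ladder.  The target [B] is meant to be a subset of [U]: the event then says
    that the sequence enters [U] at time [n.+1], and does so through [B]. *)
Definition first_hit U B (n : nat) : set T :=
  [set w | B (X n.+1 w) /\ forall j, (0 < j < n.+1)%N -> ~ U (X j w)].

(** In this form the event is a finite intersection to which independence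
    applies. *)
Lemma first_hit_bigcap U B n :
  first_hit U B n = \bigcap_(i in [set` iota 1 n.+1])
    X i @^-1` (if i == n.+1 then B else ~` U).
Proof.
have in_iota i : [set` iota 1 n.+1] i = (0 < i < n.+2)%N :> Prop.
  by rewrite /mkset mem_iota add1n.
apply/seteqP; split=> [w [Bn before] i | w hit].
  rewrite in_iota => /andP[i_gt0]; rewrite ltnS leq_eqVlt /preimage /mkset.
  by case: eqP => [->//|_ /= lt_in]; apply: before; rewrite i_gt0.
split=> [|j /andP[j_gt0 lt_jn]].
  by have := hit n.+1; rewrite in_iota ltnSn eqxx; exact.
have lt_jn2 : (j < n.+2)%N := ltnW lt_jn.
by have := hit j; rewrite in_iota j_gt0 lt_jn2 (ltn_eqF lt_jn); exact.
Qed.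

Lemma measurable_first_hit U B n :
  measurable U -> measurable B -> measurable (first_hit U B n).
Proof.
move=> mU mB; rewrite first_hit_bigcap; apply: bigcap_measurableType => i _.
rewrite -[X in measurable X]setTI; apply: measurable_funPT => //.
by case: ifP => // _; exact: measurableC.
Qed.

Lemma trivIset_first_hit U B :
  B `<=` U -> trivIset setT (first_hit U B).
Proof.
move=> BU; apply: ltn_trivIset => n m lt_mn; apply/seteqP; split=> // w [].
move=> [Bm _] [_ before].
by apply: (before m.+1); [rewrite /= ltnS | exact: BU].
Qed.

Hypothesis iid_X : iid X.

Lemma probability_first_hit U B n : measurable U -> measurable B ->
  P (first_hit U B n) = (geometric (fine (mu B)) (1 - fine (mu U)) n)%:E.
Proof.
move=> mU mB; case: iid_X => same_law indep.
have fin A : measurable A -> mu A = (fine (mu A))%:E.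
  by move=> mA; rewrite fineK ?fin_num_measure.
rewrite first_hit_bigcap.
rewrite (indep (iota 1 n.+1) (fun i => if i == n.+1 then B else ~` U)).
- rewrite (eq_bigr (fun i => if i == n.+1 then mu B else mu (~` U))); last first.
    by move=> i _; rewrite same_law; case: ifP => // _; exact: measurableC.
  have -> : iota 1 n.+1 = rcons (iota 1 n) n.+1.
    by rewrite -cats1 -[X in iota 1 X]addn1 iotaD add1n.
  rewrite -cats1 big_cat big_seq1 eqxx.
  rewrite (eq_big_seq (fun=> (1 - fine (mu U))%:E)); last first.
    move=> i; rewrite mem_iota add1n => /andP[_ lt_in].
    by rewrite (ltn_eqF lt_in) probability_setC// EFinB -fin.
  rewrite -(big_morph EFin (fun a b => EFinM a b) erefl).
  rewrite big_const_seq count_predT size_iota iter_mulr_1.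
  by rewrite /= mulrC EFinM -fin.
- exact: iota_uniq.
- by move=> i; case: ifP => // _; exact: measurableC.
Qed.

(** The law of the point of entry into [U] is [mu] conditioned on [U]: the
    probabilities of the disjoint events [first_hit U B n] form a geometric
    series of ratio [1 - mu U]. *)
Lemma probability_bigcup_first_hit U B :
    measurable U -> measurable B -> B `<=` U -> 0 < fine (mu U) ->
  P (\bigcup_n first_hit U B n) = (fine (mu B) / fine (mu U))%:E.
Proof.
move=> mU mB BU muU_gt0.
have mH n := measurable_first_hit n mU mB.
rewrite measure_bigcup//; last exact: trivIset_first_hit.
pose geo := geometric (fine (mu B)) (1 - fine (mu U)).
rewrite (eq_eseriesr (g := EFin \o geo)); last first.
  by move=> n _; exact: probability_first_hit.
have muU_le1 : fine (mu U) <= 1.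
  by rewrite -lee_fin fineK ?fin_num_measure// probability_le1.
have q_lt1 : `|1 - fine (mu U)| < 1.
  by rewrite ger0_norm ?subr_ge0// gtrBl.
transitivity (limn (EFin \o series geo)).
  congr (limn _); apply/funext => n /=; rewrite -sumEFin.
  by apply: eq_bigl => i; rewrite in_setT.
rewrite EFin_lim; last exact: is_cvg_geometric_series.
congr (_%:E); apply: cvg_lim => //.
by have := cvg_geometric_series (a := fine (mu B)) q_lt1; rewrite subKr.
Qed.

End FirstHit.

(** * The law of the second ladder variable given the first *)

Section SecondLadderVariable.
Context (d : Order.disp_t) (S : posetTopType d) (R : realType).
Context (dT : measure_display) (T : measurableType dT) (P : probability T R).
Context (X : nat -> {RV P >-> borel S}).
Local Notation mu := (distribution P (X 0%N)).

Hypothesis closed_order : closed [set p : S * S | (p.1 <= p.2)%O].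
Hypothesis iid_X : iid X.
Hypothesis upper_prob_gt0 : forall x : S, 0 < upper_prob mu x.

Let measurable_up (x : S) : measurable (up x : set (borel S)).
Proof. by apply: closed_measurable; exact: closed_up. Qed.

(** The second event gathers the paths that never return to [up x]: the ladder
    then remains at [x], which counts only if [x] lies in [B]. *)
Lemma preimage_ladder_var_given_first (x : S) (B : set (borel S)) :
  ladder_var_given_first X x 1 @^-1` B =
    \bigcup_n first_hit X (up x) (B `&` up x) n `|`
    [set w | B x /\ (~` \bigcup_n first_hit X (up x) (up x) n) w].
Proof.
have at_hit w n : first_hit X (up x) (up x) n w ->
    ladder_var_given_first X x 1 w = X n.+1 w.
  move=> [up_n before]; rewrite /ladder_var_given_first ladder1E.
  rewrite (@next_ladder_time_first _ _ _ n.+1)// => -[//|j] /before not_up_j.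
  exact/negP.
have no_hit w : ~ (\bigcup_n first_hit X (up x) (up x) n) w ->
    ladder_var_given_first X x 1 w = x.
  move=> none; rewrite /ladder_var_given_first ladder1E next_ladder_time_none//.
  move=> k0 k0_gt0; apply/negP => up_k0; apply: none.
  have ex : exists k, (0 < k)%N && (x <= X k w)%O.
    by exists k0; rewrite k0_gt0; case: k0 k0_gt0 up_k0.
  case: (ex_minnP ex) => -[//|n] /= up_n min_n; exists n => //.
  split=> // j /andP[j_gt0 lt_jn] up_j.
  have le_nj : (n.+1 <= j)%N.
    by apply: min_n; rewrite j_gt0 /=; exact: up_j.
  by rewrite ltnNge le_nj in lt_jn.
apply/seteqP; split=> w /=.
  move=> Bw.
  have [[n _ hit]|none] := pselect ((\bigcup_n first_hit X (up x) (up x) n) w).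
    left; exists n => //; rewrite (at_hit _ _ hit) in Bw.
    by case: hit => up_n before; split.
  by right; rewrite (no_hit _ none) in Bw.
move=> [[n _ [[Bn up_n] before]] | [Bx /no_hit ->]]//.
by rewrite (at_hit w n).
Qed.

(** Taking [B] to be [up x] in the geometric series shows that a return to
    [up x] is almost sure, so that the paths stuck at [x] do not contribute. *)
Lemma distribution_ladder_var_given_first (x : S) (B : set (borel S)) :
    measurable B ->
  P (ladder_var_given_first X x 1 @^-1` B) =
    (fine (mu (B `&` up x)) / upper_prob mu x)%:E.
Proof.
move=> mB; have mU := measurable_up x.
have mBU : measurable (B `&` up x) by exact: measurableI.
have mH C : measurable C -> measurable (\bigcup_n first_hit X (up x) C n).
  by move=> mC; apply: bigcupT_measurable => n; exact: measurable_first_hit.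
have never0 : P (~` \bigcup_n first_hit X (up x) (up x) n) = 0%E.
  rewrite probability_setC; last exact: mH.
  rewrite probability_bigcup_first_hit//; last exact: upper_prob_gt0.
  by rewrite divff ?subee// gt_eqF//; exact: upper_prob_gt0.
have m_miss : measurable
    [set w | B x /\ (~` \bigcup_n first_hit X (up x) (up x) n) w].
  have [Bx|nBx] := pselect (B x).
    rewrite (_ : [set w | _] = ~` \bigcup_n first_hit X (up x) (up x) n).
      by apply: measurableC; exact: mH.
    by apply/seteqP; split=> w /= => [[]|].
  rewrite (_ : [set w | _] = set0)//.
  by apply/seteqP; split=> w //= -[].
rewrite preimage_ladder_var_given_first measureU0//.
- by apply: probability_bigcup_first_hit => //; exact: upper_prob_gt0.
- exact: mH.
- apply: subset_measure0 never0 => //; last by move=> w [].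
  by apply: measurableC; exact: mH.
Qed.

Variable lambda : {measure set (borel S) -> \bar R}.
Variable f : borel S -> R.
Hypothesis pdf_f : is_pdf lambda mu f.

Lemma is_pdf_ladder_var_given_first (x : S) :
  is_pdf lambda (fun B => P (ladder_var_given_first X x 1 @^-1` B))
    (fun y => (upper_prob mu x)^-1 * (f \_ (up x)) y).
Proof.
have [mf f_ge0 f_int] := pdf_f.
have m_restr : measurable_fun [set: borel S] (f \_ (up x)).
  by apply/(measurable_restrictT f) => //; exact: measurable_funTS.
have restr_ge0 y : 0 <= (f \_ (up x)) y by rewrite patchE; case: ifP.
split=> [|y|B mB].
- exact: measurable_funM.
- by rewrite mulr_ge0// invr_ge0 ltW.
rewrite distribution_ladder_var_given_first//.
under eq_integral do rewrite EFinM.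
rewrite ge0_integralZl//.
- have -> : (\int[lambda]_(y in B) ((f \_ (up x)) y)%:E)%E = mu (B `&` up x).
    rewrite f_int; last exact: measurableI.
    rewrite integral_mkcondr; apply: eq_integral => y _.
    by rewrite !patchE; case: ifP.
  rewrite mulrC EFinM fineK// fin_num_measure//; exact: measurableI.
- by apply/measurable_EFinP; exact: measurable_funTS.
- by move=> y _; rewrite lee_fin.
- by rewrite lee_fin invr_ge0 ltW.
Qed.

End SecondLadderVariable.

(** * Comparing the rates of comparable points *)

Section RateComparison.
Context (d : Order.disp_t) (S : posetTopType d) (R : realType).
Variable lambda : {measure set (borel S) -> \bar R}.

(** Finite total mass makes the densities integrable, so that equal integrals
    over all Borel sets force equality almost everywhere. *)
Lemma pdf_ae_unique (nu : set (borel S) -> \bar R) (g1 g2 : borel S -> R) :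
  (nu setT < +oo)%E -> is_pdf lambda nu g1 -> is_pdf lambda nu g2 ->
  {ae lambda, forall y, g1 y = g2 y}.
Proof.
move=> nu_fin [mg1 g1_ge0 nu1] [mg2 g2_ge0 nu2].
have int1 : lambda.-integrable setT (EFin \o g1).
  apply/integrableP; split; first exact/measurable_EFinP.
  rewrite (eq_integral (EFin \o g1)) -?nu1// => y _.
  by rewrite /= ger0_norm.
have mg2E : measurable_fun setT (EFin \o g2) by exact/measurable_EFinP.
have agree (A : set (borel S)) : A `<=` setT -> measurable A ->
    (\int[lambda]_(y in A) (EFin \o g1) y =
     \int[lambda]_(y in A) (EFin \o g2) y)%E.
  by move=> _ mA; rewrite -nu1 -?nu2.
have := integral_ae_eq measurableT int1 mg2E agree.
by apply: filterS => y /(_ I) [].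
Qed.

(** A density that is positive on [down y] cannot come from a zero normalizing
    constant, since a quotient by 0 is 0; so the normalization of [h _ y] can be
    cancelled. *)
Lemma uniform_cond_pdf_eq (h : borel S -> borel S -> R) (y x x' : S) :
    is_uniform_pdf lambda (Defs.down y) (cond_pdf lambda h y) ->
    (x <= y)%O -> (x' <= y)%O ->
  h x y = h x' y.
Proof.
move=> [D_gt0 D_fin unif] le_xy le_x'y.
have fineD_gt0 : 0 < fine (lambda (Defs.down y)).
  by apply: fine_gt0; rewrite D_gt0.
have cond z : (z <= y)%O ->
    cond_pdf lambda h y z = (fine (lambda (Defs.down y)))^-1.
  by move=> le_zy; rewrite unif indicE mem_set// mul1r.
have g_neq0 : (fine (\int[lambda]_u (h u y)%:E)%E)^-1 != 0.
  apply: contraTneq fineD_gt0 => g0; have := cond _ le_xy.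
  rewrite /cond_pdf g0 mulr0 => /esym/eqP.
  by rewrite invr_eq0 => /eqP ->; rewrite ltxx.
by apply: (mulIf g_neq0); rewrite -!/(cond_pdf lambda h y _) !cond.
Qed.

Context (dT : measure_display) (T : measurableType dT) (P : probability T R).
Context (X : nat -> {RV P >-> borel S}).
Local Notation mu := (distribution P (X 0%N)).

(** A ladder variable is one of the [X k], and countably many of them avoid a
    [lambda]-null set almost surely, because their common law has a density. *)
Lemma ae_ladder_var (f : borel S -> R) (Q : S -> Prop) (n : nat) :
    iid X -> is_pdf lambda mu f ->
    {ae lambda, forall y, Q y} -> {ae P, forall w, Q (ladder_var X n w)}.
Proof.
move=> [same_law _] [mf _ f_int] [A [mA A0 QA]].
apply: (@negligibleS _ _ _ P (\bigcup_k X k @^-1` A)).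
  by move=> w notQ; exists (ladder_time (fun k => X k w) n) => //; exact: QA.
apply: negligible_bigcup => k.
apply/negligibleP; first exact: measurable_funPTI.
transitivity (mu A); first exact: same_law.
rewrite f_int// null_set_integral//.
by apply/measurable_EFinP; exact: measurable_funTS.
Qed.

Lemma ae_witness (A : set T) (Q : T -> Prop) :
  measurable A -> (0 < P A)%E -> {ae P, forall w, Q w} -> exists2 w, A w & Q w.
Proof.
move=> mA PA_gt0 aeQ; apply: contrapT => none.
have /negligibleP : P.-negligible A.
  apply: negligibleS aeQ => w Aw Qw; apply: none; exists w => //.
by move=> /(_ mA) PA0; rewrite PA0 ltxx in PA_gt0.
Qed.

(** The densities of Y_2 given Y_1 = x and given Y_1 = x' are both evaluated at
    one good value y of Y_2 above x', where uniformity makes the two values of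
    the joint density coincide. *)
Lemma le_rate_eq (f : borel S -> R) :
    closed [set p : S * S | (p.1 <= p.2)%O] -> iid X ->
    (forall x, 0 < upper_prob mu x) ->
    is_pdf lambda mu f -> (forall x, 0 < f x) ->
    cond_uniform X lambda f ->
  forall x x' : S, (x <= x')%O ->
    f x / upper_prob mu x = f x' / upper_prob mu x'.
Proof.
move=> closed_order iid_X F_gt0 pdf_f f_gt0 [h [_ _ cond_h] unif] x x' le_xx'.
have density z : {ae lambda, forall y,
    h z y / f z = (upper_prob mu z)^-1 * (f \_ (up z)) y}.
  apply: pdf_ae_unique (cond_h z) _; last exact: is_pdf_ladder_var_given_first.
  by rewrite preimage_setT probability_setT ltry.
have ae_x := ae_ladder_var 1 iid_X pdf_f (density x).
have ae_x' := ae_ladder_var 1 iid_X pdf_f (density x').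
have m_up : measurable (up x' : set (borel S)).
  by apply: closed_measurable; exact: closed_up.
have m_X0_up : measurable (X 0%N @^-1` (up x' : set (borel S))).
  exact: measurable_funPTI.
have up_gt0 : (0 < P (X 0%N @^-1` up x'))%E.
  have : (0 < (upper_prob mu x')%:E)%E by rewrite lte_fin.
  by rewrite fineK// fin_num_measure.
have [w le_x'X [[unif_w hx] hx']] :=
  ae_witness m_X0_up up_gt0 (filterI (filterI unif ae_x) ae_x').
set y := ladder_var X 1 w in unif_w hx hx'.
have le_x'y : (x' <= y)%O := le_trans le_x'X (ladder1_ge _).
have le_xy : (x <= y)%O := le_trans le_xx' le_x'y.
have h_eq z : (z <= y)%O ->
    h z y / f z = (upper_prob mu z)^-1 * (f \_ (up z)) y ->
    h z y = f z / upper_prob mu z * f y.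
  move=> le_zy; rewrite patchE mem_set// => /(congr1 ( *%R^~ (f z))).
  by rewrite divfK ?gt_eqF// => ->; rewrite [f z / _]mulrC mulrAC.
apply: (mulIf (lt0r_neq0 (f_gt0 y))).
by rewrite -!h_eq//; exact: uniform_cond_pdf_eq unif_w le_xy le_x'y.
Qed.

End RateComparison.

(** * Constancy of the rate *)

Theorem proposition8 (R : realType) (d : Order.disp_t) (S : posetTopType d)
  (lambda : {measure set (borel S) -> \bar R})
  (standard : standard_poset lambda) (connected_S : @poset_connected d S)
  (dT : measure_display) (T : measurableType dT) (P : probability T R)
  (X : nat -> {RV P >-> borel S}) (iid_X : iid X)
  (support_X : has_full_support (distribution P (X 0%N)))
  (upper_prob_gt0 : forall x : S, 0 < upper_prob (distribution P (X 0%N)) x)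
  (f : borel S -> R) (pdf_f : is_pdf lambda (distribution P (X 0%N)) f)
  (f_gt0 : forall x : S, 0 < f x)
  (uniform_Y1_given_Y2 : cond_uniform X lambda f) :
  constant_rate lambda (distribution P (X 0%N)).
Proof.
have rate_le := le_rate_eq (sp_closed_order standard) iid_X upper_prob_gt0 pdf_f
  f_gt0 uniform_Y1_given_Y2.
set F := upper_prob _ in upper_prob_gt0 rate_le *.
have rate_path x (s : seq S) : path (fun a b : S => (a >=< b)%O) x s ->
    f (last x s) / F (last x s) = f x / F x.
  elim: s x => //= z s IHs x /andP[/orP cmp_xz /IHs ->].
  by case: cmp_xz => /rate_le.
pose o : S := point.
exists (f o / F o); split; first by rewrite divr_gt0.
have -> : (fun x => f o / F o * F x) = f; last exact: pdf_f.
apply/funext => x; have [s [path_s <-]] := connected_S o x.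
by rewrite -(rate_path _ _ path_s) divfK// gt_eqF.
Qed.
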